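(* For every positive integer $k$ and every prime $p\ge 5$, $[C_{p^k}]=\{C_{p^k},D_{p^k}\}$.
   Context: All graphs are finite, undirected and simple, considered up to isomorphism. The independence polynomial of a graph $G$ is $i(G,x)=\sum_{j\ge 0} i_j x^j$, where $i_j$ is the number of independent sets (vertex sets inducing no edges) of size $j$. The independence equivalence class $[G]$ is the set of graphs $H$ with $i(H,x)=i(G,x)$. $C_n$ is the cycle on $n$ vertices, and for $n\ge 3$, $D_n$ is the graph on vertices $u_1,\dots,u_n$ with edges $u_1u_2,u_1u_3,u_2u_3$ and $u_ju_{j+1}$ for $3\le j\le n-1$. *)

(* Defs.v *)
From mathcomp Require Import all_boot all_order all_algebra.

Set Implicit Arguments.
Unset Strict Implicit.
Unset Printing Implicit Defensive.

Import GRing.Theory.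

Record sgraph := SGraph {
  vertex :> finType;
  adj : rel vertex;
  adj_sym : symmetric adj;
  adj_irrefl : irreflexive adj
}.

Definition isomorphic (G H : sgraph) : Prop :=
  exists2 f : G -> H, bijective f & forall x y, adj (f x) (f y) = adj x y.

Definition independent (G : sgraph) (A : {set G}) : bool :=
  [forall x in A, forall y in A, ~~ adj x y].

Definition indep_num (G : sgraph) (j : nat) : nat :=
  #|[set A : {set G} | independent A & #|A| == j]|.

(* No independent set has more than #|G| elements, so the sum over all
   j >= 0 stops there. *)
Definition indep_poly (G : sgraph) : {poly int} :=
  (\sum_(j < #|G|.+1) (indep_num G j)%:R *: 'X^j)%R.

Definition indep_class (G : sgraph) : sgraph -> Prop :=
  fun H => indep_poly H = indep_poly G.

(* [ordS] is the successor modulo n; the disequality only matters for n = 1,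
   where it removes the loop. *)
Definition cycle_adj (n : nat) : rel 'I_n :=
  fun x y => (x != y) && ((y == ordS x) || (x == ordS y)).

Lemma cycle_adj_sym n : symmetric (@cycle_adj n).
Proof. by move=> x y; rewrite /cycle_adj eq_sym orbC. Qed.

Lemma cycle_adj_irrefl n : irreflexive (@cycle_adj n).
Proof. by move=> x; rewrite /cycle_adj eqxx. Qed.

(* The graph C_n, for n >= 3. *)
Definition cycle_graph (n : nat) : sgraph :=
  SGraph (@cycle_adj_sym n) (@cycle_adj_irrefl n).

(* The edges of D_n, each listed once; the vertex u_j is the number j - 1. *)
Definition D_edge (i j : nat) : bool :=
  [|| (i == 0) && (j == 1), (i == 0) && (j == 2), (i == 1) && (j == 2)
    | (2 <= i) && (j == i.+1)].

Definition D_adj (n : nat) : rel 'I_n :=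
  fun x y => D_edge x y || D_edge y x.

Lemma D_adj_sym n : symmetric (@D_adj n).
Proof. by move=> x y; rewrite /D_adj orbC. Qed.

Lemma D_adj_irrefl n : irreflexive (@D_adj n).
Proof.
move=> x; rewrite /D_adj orbb /D_edge.
by case: (nat_of_ord x) => [|[|[|m]]] //=; rewrite ltn_eqF.
Qed.

(* The graph D_n, for n >= 3. *)
Definition D_graph (n : nat) : sgraph :=
  SGraph (@D_adj_sym n) (@D_adj_irrefl n).

(* Main.v *)
Require Import Defs.
From mathcomp Require Import all_boot all_order all_algebra.
From mathcomp Require Import zify ring lra.

(* Let [n = p ^ k] and let H have the same independence polynomial as C_n.
   With [x = a^2 - a] the polynomial of C_n takes the value [a^n + (1-a)^n], so
   modulo p it is 1 by Frobenius.  The polynomial of each connected component K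
   of H divides it, hence is also 1 modulo p, so p divides both the order and
   the degree sum of K.  As [p >= 5], K is not a tree, and since H has as many
   edges as vertices every component is unicyclic.  The coefficient of x^3 then
   gives [sum_v (deg v - 2)^2 = 2 * #triangles]; as a unicyclic graph has at most
   one triangle, this holds on each component, which is therefore a cycle or
   some D_m.  Finally, at [x = -1/4] both C_m and D_m take the value [2 / 2^m], so
   comparing the powers of 2 shows that there is a single component. *)

Set Implicit Arguments.
Unset Strict Implicit.
Unset Printing Implicit Defensive.

Import Order.TTheory GRing.Theory Num.Theory.

(** * Weighted sums over independent sets *)

Section Weight.
Variable G : sgraph.
Implicit Types (A B S W : {set G}) (u v : G).

Definition cnbr v : {set G} := [set u | (u == v) || adj v u].

Lemma independentP A :
  reflect {in A &, forall u v, ~~ adj u v} (independent A).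
Proof.
apply: (iffP forall_inP) => [h u v uA vA|h u uA].
  by have /forall_inP := h u uA; apply.
by apply/forall_inP => v vA; apply: h.
Qed.

Lemma independentU1 v A :
  independent (v |: A) = independent A && [forall u in A, ~~ adj v u].
Proof.
apply/independentP/andP => [h|[/independentP h /forall_inP hv]].
  split; last by apply/forall_inP => u uA; apply: h; rewrite !inE ?eqxx ?uA ?orbT.
  by apply/independentP => u w uA wA; apply: h; rewrite !inE ?uA ?wA orbT.
move=> u w; rewrite !inE => /orP[/eqP->|uA] /orP[/eqP->|wA].
- by rewrite adj_irrefl.
- exact: hv.
- by rewrite adj_sym hv.
- exact: h.
Qed.

Section Ring.
Variables (R : comNzRingType) (x : R).
Local Open Scope ring_scope.

(** The independence polynomial of the subgraph induced on [W], evaluated at [x]. The ring is left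
    free because polynomials over [int] and ['F_p] and rational values are all needed. *)
Definition wt W : R :=
  \sum_(A : {set G} | independent A && (A \subset W)) x ^+ #|A|.

(** Removing [v] is a bijection from the independent sets through [v] onto those that avoid its
    closed neighbourhood. *)
Lemma wt_through W v : v \in W ->
  \sum_(A : {set G} | (independent A && (A \subset W)) && (v \in A)) x ^+ #|A| =
    x * wt (W :\: cnbr v).
Proof.
move=> vW; rewrite (reindex_onto (fun A => v |: A) (fun A => A :\ v)) /=; last first.
  by move=> A /andP[_ vA]; rewrite setD1K.
rewrite /wt mulr_sumr; apply: eq_big => [A|A /andP[_ /eqP hA]]; last first.
  have vA : v \notin A by rewrite -hA !inE eqxx.
  by rewrite cardsU1 vA exprS.
rewrite independentU1 subUset sub1set vW !inE eqxx /= andbT -!andbA.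
case: (independent A) => //=.
apply/and3P/subsetP => [[/forall_inP hv /subsetP AW /eqP hA] u uA|h].
  rewrite !inE AW // andbT negb_or hv // andbT.
  by apply: contraTneq uA => ->; rewrite -hA !inE eqxx.
have h' u : u \in A -> [/\ u \in W, u != v & ~~ adj v u].
  by move=> /h; rewrite !inE negb_or => /andP[/andP[-> ->] ->].
split; first by apply/forall_inP => u /h'[].
  by apply/subsetP => u /h'[].
rewrite setU1K //; apply/negP => /h'[_]; by rewrite eqxx.
Qed.

Lemma wt_rec W v : v \in W -> wt W = wt (W :\ v) + x * wt (W :\: cnbr v).
Proof.
move=> vW; rewrite -(wt_through vW) /wt (bigID (fun A => v \in A)) /= addrC.
congr (_ + _); apply: eq_bigl => A.
by rewrite subsetD1 andbA.
Qed.

Lemma wt0 : wt set0 = 1.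
Proof.
rewrite /wt (big_pred1 set0) ?cards0 ?expr0 // => A.
rewrite subset0 /=; case: eqP => [->|]; rewrite ?andbF // andbT.
by apply/independentP => u v; rewrite inE.
Qed.

(** Both sides obey the same recurrence when a vertex [v] of [S] is deleted, since neither [v] nor
    any neighbour of [v] lies in [W]. *)
Lemma wtU S W : {in S & W, forall u v, (u != v) && ~~ adj u v} ->
  wt (S :|: W) = wt S * wt W.
Proof.
have [m] := ubnP #|S|; elim: m S => // m IHm S /ltnSE leSm h.
have [->|[v vS]] := set_0Vmem S; first by rewrite set0U wt0 mul1r.
have vW : v \notin W by apply/negP => /(h _ _ vS); rewrite eqxx.
rewrite (wt_rec vS) (@wt_rec (S :|: W) v) ?inE ?vS // mulrDl -mulrA.
rewrite -!IHm.
- congr (wt _ + x * wt _); apply/setP => u; rewrite !inE.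
    by case: eqP => // ->; rewrite (negbTE vW).
  case uW: (u \in W); rewrite ?orbF //= !orbT andbT.
  by have /andP[] := h _ _ vS uW; rewrite negb_or eq_sym => -> ->.
- apply: leq_trans leSm; apply: proper_card; apply/properP; split.
    by apply: subsetDl.
  by exists v; rewrite // !inE eqxx.
- by move=> u w; rewrite !inE => /andP[_ uS]; apply: h.
- by apply: leq_trans leSm; rewrite [X in (_ <= X)%N](cardsD1 v) vS.
- by move=> u w; rewrite !inE => /andP[_ uS]; apply: h.
Qed.

Lemma wt_closed S W : closed (@adj G) (mem S) -> S \subset W ->
  wt W = wt S * wt (W :\: S).
Proof.
move=> clS SW; rewrite -wtU; first by rewrite setDE setUIr setUCr setIT (setUidPr SW).
move=> u v uS; rewrite inE => /andP[vS _].
apply/andP; split; first by apply: contraNneq vS => <-.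
by apply: contra vS => /clS /=; rewrite uS => <-.
Qed.

(** The bound [N] is free so that two graphs can be expanded up to the same degree before their
    orders are known to agree. *)
Lemma wt_indep_num N : (#|G| < N)%N ->
  wt setT = \sum_(j < N) (indep_num G j)%:R * x ^+ j.
Proof.
move=> hN; rewrite /wt.
have hA (A : {set G}) : (#|A| < N)%N by apply: leq_ltn_trans hN; apply: max_card.
rewrite (partition_big (fun A => Ordinal (hA A)) predT) //=.
apply: eq_bigr => j _; rewrite /indep_num.
rewrite -sum1_card natr_sum mulr_suml; apply: eq_big => [A|A /andP[_ /eqP <-]].
  by rewrite inE subsetT andbT -val_eqE.
by rewrite mul1r.
Qed.

End Ring.

Local Open Scope ring_scope.

(** Multiplied by ['X], both sides count the pairs of an independent set [A] and a vertex of [A],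
    weighted by ['X ^+ #|A|]. *)
Lemma deriv_wt (R : comNzRingType) W :
  (wt 'X W : {poly R})^`() = \sum_(v in W) wt 'X (W :\: cnbr v).
Proof.
have Xinj : injective (fun q : {poly R} => 'X * q).
  move=> q r h; apply/polyP => i.
  by have := congr1 (fun s : {poly R} => s`_i.+1) h; rewrite !coefXM.
apply: Xinj; rewrite /= mulr_sumr.
under [RHS]eq_bigr => v vW do rewrite -wt_through //.
rewrite (exchange_big_dep (fun A : {set G} => independent A && (A \subset W))) /=;
  last by move=> v A _ /andP[].
rewrite raddf_sum mulr_sumr; apply: eq_bigr => A /andP[iA AW].
rewrite [X in _ * X]derivXn (eq_bigl (mem A)); last first.
  move=> v /=; rewrite iA AW /=; apply: andb_idl; exact: (subsetP AW).
rewrite sumr_const mulrnAr; case: #|A| => [|m] /=; first by rewrite !mulr0n.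
by rewrite -exprS.
Qed.

Lemma coef0_wt (R : comNzRingType) W : (wt 'X W : {poly R})`_0 = 1.
Proof.
rewrite /wt (bigD1 set0) /= ?cards0 ?expr0; last first.
  by rewrite sub0set andbT; apply/independentP => u v; rewrite inE.
rewrite coefD coef1 coef_sum big1 ?addr0 // => A /andP[_ A0].
by rewrite coefXn eq_sym cards_eq0 (negbTE A0).
Qed.

End Weight.

(** * Independence equivalence as equality in every ring *)

Section Class.
Local Open Scope ring_scope.

Lemma coef_indep_poly (G : sgraph) j : (indep_poly G)`_j = (indep_num G j)%:R.
Proof.
rewrite /indep_poly coef_sum.
under eq_bigr => i _ do rewrite coefZ coefXn.
have [hj|hj] := ltnP j #|G|.+1.
  rewrite (bigD1 (Ordinal hj)) //= eqxx mulr1 big1 ?addr0 // => i ij.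
  by rewrite eq_sym -[j]/(val (Ordinal hj)) val_eqE (negbTE ij) mulr0.
rewrite big1 => [|i _]; last first.
  by rewrite gtn_eqF ?mulr0 // (leq_trans (ltn_ord i)).
rewrite /indep_num eq_card0 // => A; rewrite !inE.
case: eqP => [hA|]; rewrite ?andbF // andbT.
by have := leq_trans hj (eq_leq (esym hA)); rewrite ltnNge max_card.
Qed.

(** The coefficients are natural numbers, so equality over [int] passes to every ring; conversely,
    [x = 'X] over [int] recovers the polynomial. *)
Lemma indep_classP (G H : sgraph) : indep_class G H <->
  (forall (R : comNzRingType) (x : R), wt x [set: H] = wt x [set: G]).
Proof.
split=> [h R x|h].
  have hn j : indep_num H j = indep_num G j.
    have := congr1 (fun q : {poly int} => q`_j) h.
    by rewrite !coef_indep_poly => /eqP; rewrite eqr_nat => /eqP.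
  rewrite !(@wt_indep_num _ _ _ (maxn #|H| #|G|).+1) ?ltnS ?leq_maxl ?leq_maxr //.
  by apply: eq_bigr => j _; rewrite hn.
have hp (K : sgraph) : indep_poly K = wt 'X [set: K].
  rewrite (wt_indep_num _ (ltnSn _)); apply: eq_bigr => j _.
  by rewrite -mul_polyC polyC_natr.
by rewrite /indep_class !hp h.
Qed.

End Class.

(** * The coefficients of low degree *)

Section Coefficients.
Variables (G : sgraph) (R : comNzRingType).
Local Open Scope ring_scope.
Implicit Type W : {set G}.
Local Notation p W := (wt 'X W : {poly R}).

(** The factor [i.+1] is not divided out, as the ring may have positive characteristic. *)
Lemma coefS_wt W i : (p W)`_i.+1 *+ i.+1 = \sum_(v in W) (p (W :\: cnbr v))`_i.
Proof. by rewrite -coef_deriv deriv_wt coef_sum. Qed.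

Lemma coef1_wt W : (p W)`_1 = #|W|%:R.
Proof.
rewrite -[LHS]mulr1n coefS_wt -sum1_card natr_sum.
by apply: eq_bigr => v _; rewrite coef0_wt.
Qed.

Lemma coef2_wt W : (p W)`_2 *+ 2 = \sum_(v in W) #|W :\: cnbr v|%:R.
Proof. by rewrite coefS_wt; apply: eq_bigr => v _; rewrite coef1_wt. Qed.

Lemma coef3_wt W :
  (p W)`_3 *+ 6 = \sum_(v in W) \sum_(u in W :\: cnbr v)
                     #|W :\: cnbr v :\: cnbr u|%:R.
Proof.
rewrite -[6%N]/(3 * 2)%N mulrnA coefS_wt -sumrMnl.
by apply: eq_bigr => v _; rewrite coef2_wt.
Qed.

End Coefficients.

(** * Path and cycle polynomials *)

Section CycleWeight.
Variables (R : comNzRingType) (x : R).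
Local Open Scope ring_scope.

Fixpoint path_wt (m : nat) : R :=
  match m with
  | 0 => 1
  | m1.+1 => if m1 is m2.+1 then path_wt m1 + x * path_wt m2 else 1 + x
  end.

(** Deletion of one vertex of C_n: what remains is a path on [n - 1] vertices, or on [n - 3] once
    the two neighbours go too. *)
Definition cycle_wt (n : nat) : R := path_wt n.-1 + x * path_wt (n - 3).

Lemma path_wtSS m : path_wt m.+2 = path_wt m.+1 + x * path_wt m.
Proof. by []. Qed.

Lemma cycle_wtSS m : (2 < m)%N ->
  cycle_wt m.+2 = cycle_wt m.+1 + x * cycle_wt m.
Proof.
case: m => [|[|[|m]]] // _.
by rewrite /cycle_wt !subSS !subn0 !PeanoNat.Nat.pred_succ (path_wtSS m.+2) (path_wtSS m); ring.
Qed.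

(** Two-step induction from the polynomials of C_4 and C_5. The value is an argument of [P], so the
    same scheme serves a closed form in any ring and the coefficients of a polynomial. *)
Lemma cycle_wt_ind (P : nat -> R -> Prop) :
    P 4%N (1 + x *+ 4 + x ^+ 2 *+ 2) -> P 5%N (1 + x *+ 5 + x ^+ 2 *+ 5) ->
    (forall m a b, (3 < m)%N -> P m a -> P m.+1 b -> P m.+2 (b + x * a)) ->
  forall n, (3 < n)%N -> P n (cycle_wt n).
Proof.
move=> P4 P5 PS n n2; suff: P n (cycle_wt n) /\ P n.+1 (cycle_wt n.+1) by case.
elim: n n2 => // n IHn; rewrite ltnS leq_eqVlt => /predU1P[<-|n2].
  rewrite /cycle_wt /=; split; [move: P4 | move: P5]; congr (P _ _); ring.
have [Pn PSn] := IHn n2; rewrite cycle_wtSS; last exact: ltnW n2.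
by split; last exact: PS n2 Pn PSn.
Qed.

(** Both [a] and [1 - a] are roots of [t ^+ 2 = t + x], the characteristic equation of the
    recurrence. *)
Lemma cycle_wtE a n : x = a ^+ 2 - a -> (3 < n)%N ->
  cycle_wt n = a ^+ n + (1 - a) ^+ n.
Proof.
move=> hx; move: n.
apply: (cycle_wt_ind (P := fun n y => y = a ^+ n + (1 - a) ^+ n)) => [||m c d _ -> ->];
  rewrite hx ?exprS; ring.
Qed.

End CycleWeight.

Lemma coef_cycle_wt n : 3 < n -> let q := cycle_wt ('X : {poly int}) n in
  ([/\ q`_0 = 1, q`_1 = n%:Z, q`_2 *+ 2 = n%:Z * (n%:Z - 3) &
      q`_3 *+ 6 = n%:Z * (n%:Z - 4) * (n%:Z - 5)])%R.
Proof.
move=> /= n_gt3; apply: (cycle_wt_ind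
  (P := fun n (q : {poly int}) => [/\ q`_0 = 1, q`_1 = n%:Z,
    q`_2 *+ 2 = n%:Z * (n%:Z - 3) & q`_3 *+ 6 = n%:Z * (n%:Z - 4) * (n%:Z - 5)]%R))
  => [||m a b m2 [a0 a1 a2 a3] [b0 b1 b2 b3]|] //.
1,2: by rewrite !coefD ?coefMn !coef1 !coefX ?coefXn /=; split; lia.
rewrite !coefD !coefXM /= !mulrnDl a0 a1 b0 b1 b2 b3.
split; [lia|lia|lia|].
by rewrite -[6%N]/(2 * 3)%N mulrnA a2; lia.
Qed.

(** * A common enumeration of C_n and D_n *)

Section Lollipop.
Variables (G : sgraph) (n k : nat) (f : nat -> G).

(* For [i < n], the vertices [f i] form a path closed up by an edge from [f 0]
   to [f k]; this is C_n for [k = n.-1] and D_n for [k = 2]. *)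
Definition lolli_edge (i j : nat) : bool :=
  (j == i.+1) || ((i == 0) && (j == k)).

Definition lolli_enum : Prop :=
  {in gtn n &, injective f} /\
  {in gtn n &, forall i j, adj (f i) (f j) = lolli_edge i j || lolli_edge j i}.

Definition seg (P : pred nat) : {set G} := [set f (val i) | i : 'I_n & P i].

Lemma eq_seg (P Q : pred nat) : (forall i, i < n -> P i = Q i) -> seg P = seg Q.
Proof.
move=> h; apply/setP => u.
by apply/imsetP/imsetP => -[i]; rewrite inE => Pi ->; exists i; rewrite // inE; move: Pi; rewrite h.
Qed.

Hypothesis fP : lolli_enum.

Lemma mem_seg P i : i < n -> (f i \in seg P) = P i.
Proof.
move=> hi; apply/imsetP/idP => [[j]|Pi]; last by exists (Ordinal hi); rewrite ?inE.
by rewrite inE => Pj /(fP.1 _ _ hi (ltn_ord j)) ->.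
Qed.

Lemma segD1 P i : i < n -> seg P :\ f i = seg (fun j => P j && (j != i)).
Proof.
move=> hi; apply/setP => u; rewrite !inE; apply/andP/imsetP => [[ui /imsetP[j]]|[j]].
  rewrite inE => Pj hu; exists j => //; rewrite inE /= Pj.
  by apply: contraNneq ui => <-; rewrite hu.
rewrite inE /= => /andP[Pj ji ->]; rewrite mem_seg // Pj; split=> //.
by apply: contraNneq ji => /(fP.1 _ _ (ltn_ord j) hi) ->.
Qed.

Lemma segD_cnbr P i : i < n -> seg P :\: cnbr (f i) =
  seg (fun j => [&& P j, j != i & ~~ (lolli_edge i j || lolli_edge j i)]).
Proof.
move=> hi; apply/setP => u; rewrite !inE negb_or.
apply/andP/imsetP => [[/andP[ui aui] /imsetP[j]]|[j]].
  rewrite inE => Pj hu; exists j => //; rewrite inE /= Pj -fP.2 ?inE ?ltn_ord //= -[f j]hu aui.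
  by rewrite andbT; apply: contraNneq ui => <-; rewrite hu.
rewrite inE /= => /and3P[Pj ji aij ->]; rewrite mem_seg // Pj fP.2 ?inE //.
split=> //; apply/andP; split=> //.
by apply: contraNneq ji => /(fP.1 _ _ (ltn_ord j) hi) ->.
Qed.

Variables (R : comNzRingType) (x : R).
Local Open Scope ring_scope.

Lemma wt_eq_seg (P Q : pred nat) :
  (forall i, (i < n)%N -> P i = Q i) -> wt x (seg P) = wt x (seg Q).
Proof. by move=> /eq_seg ->. Qed.

(** As [0 < a], the vertex [f 0] is left out and with it the closing edge: what is left is an
    induced path. *)
Lemma wt_seg_path a m : (0 < a)%N -> (a + m <= n)%N ->
  wt x (seg (fun i => a <= i < a + m)%N) = path_wt x m.
Proof.
move=> a_gt0 le_n.
(* The recurrence of [path_wt] reaches two steps back, so the lengths [m] and [m.+1] are treated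
   together. *)
suff: (forall a, 0 < a -> a + m <= n ->
         wt x (seg (fun i => a <= i < a + m)%N) = path_wt x m)%N /\
      (forall a, 0 < a -> a + m.+1 <= n ->
         wt x (seg (fun i => a <= i < a + m.+1)%N) = path_wt x m.+1)%N.
  by case=> + _; apply.
have seg0 P : (forall i, i < n -> ~~ P i)%N -> seg P = set0.
  move=> P0; apply/setP => u; rewrite inE; apply/negP => /imsetP[i].
  by rewrite inE (negbTE (P0 i (ltn_ord i))).
elim: m {a a_gt0 le_n} => [|m [IH1 IH2]]; split=> // a a0 le_n.
- by rewrite seg0 ?wt0 // => i _; lia.
- have ha : (a < n)%N by lia.
  rewrite (@wt_rec _ _ _ _ (f a)) ?mem_seg ?leqnn ?addn1 //=.
  rewrite segD1 // segD_cnbr // !seg0 ?wt0 ?mulr1 // => i _; rewrite /lolli_edge; lia.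
- have ha : (a < n)%N by lia.
  rewrite (@wt_rec _ _ _ _ (f a)); last by rewrite mem_seg //=; lia.
  rewrite segD1 // segD_cnbr // path_wtSS -(IH2 a.+1) ?(IH1 a.+2) -?(IH1 a.+2); try lia.
  congr (_ + x * _); apply: wt_eq_seg => i hi; rewrite /lolli_edge; lia.
Qed.

(** Deleting [f 0] leaves a path on [n - 1] vertices; deleting also its neighbours [f 1] and [f k]
    leaves one on [n - 3], for either value of [k]. This is why C_n and D_n are equivalent. *)
Lemma wt_lolli : (2 < n)%N -> k = 2%N \/ k = n.-1 -> wt x (seg predT) = cycle_wt x n.
Proof.
move=> n2 hk; rewrite (@wt_rec _ _ _ _ (f 0)) ?mem_seg //=; last by lia.
rewrite segD1 ?segD_cnbr; try lia.
have [a ha] : exists a : nat, (a = 3 /\ k = 2 \/ a = 2 /\ k = n.-1)%N.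
  by case: hk => ->; [exists 3%N; left | exists 2%N; right].
have h1 := @wt_seg_path 1%N n.-1 isT; have h2 := @wt_seg_path a (n - 3)%N.
rewrite /cycle_wt -h1 -?h2; try lia.
by congr (_ + x * _); apply: wt_eq_seg => i hi; rewrite /lolli_edge /=; lia.
Qed.
End Lollipop.

(** * Coefficients in terms of degrees and triangles *)

Section Degrees.
Variable G : sgraph.
Implicit Types (u v w : G) (W : {set G}).

Definition deg v : nat := \sum_(u : G) adj v u.
(** Ordered pairs are counted, so a triangle through [v] counts twice, and the sum over all [v] is
    six times the number of triangles. *)
Definition tri v : nat := \sum_(u : G) \sum_(w : G) [&& adj v u, adj v w & adj u w].

Lemma degE v : deg v = #|[set u | adj v u]|.
Proof.
by rewrite -sum1_card big_mkcond; apply: eq_bigr => u _; rewrite inE; case: adj.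
Qed.

Lemma card_cnbr v : #|cnbr v| = (deg v).+1.
Proof.
have -> : cnbr v = v |: [set u | adj v u] by apply/setP => u; rewrite !inE.
by rewrite cardsU1 inE adj_irrefl degE.
Qed.

Local Open Scope ring_scope.

Lemma coef2_wt_closed (R : comNzRingType) W : closed (@adj G) (mem W) ->
  (wt 'X W : {poly R})`_2 *+ 2 =
    #|W|%:R * (#|W|%:R - 1) - (\sum_(v in W) deg v)%:R.
Proof.
move=> cl; rewrite coef2_wt natr_sum mulr_natl -[_ *+ #|W|]sumr_const -sumrB.
apply: eq_bigr => v vW.
have sub : cnbr v \subset W.
  apply/subsetP => u; rewrite inE => /predU1P[->//|/cl /=]; by rewrite vW => <-.
rewrite cardsD (setIidPr sub) natrB ?subset_leq_card // card_cnbr -addn1 natrD.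
by rewrite opprD [- _ - 1]addrC addrA.
Qed.

Section Triples.
Let a v u : int := (adj v u)%:R.
(** The entries of I + A, where A is the adjacency matrix; [1 - e v u] indicates that [u] avoids the
    closed neighbourhood of [v]. *)
Let e v u : int := (v == u)%:R + a v u.
Let s v : int := 1 + (deg v)%:Z.

Let aC v u : a v u = a u v. Proof. by rewrite /a adj_sym. Qed.
Let eC v u : e v u = e u v. Proof. by rewrite /e aC eq_sym. Qed.
Let sum_a v : \sum_u a v u = (deg v)%:Z.
Proof. by rewrite /deg -natz natr_sum. Qed.
Let sum_delta v (F : G -> int) : \sum_u (v == u)%:R * F u = F v.
Proof.
rewrite (bigD1 v) //= eqxx mul1r big1 ?addr0 // => u uv.
by rewrite eq_sym (negbTE uv) mul0r.
Qed.
Let sum_e v : \sum_u e v u = s v.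
Proof.
rewrite big_split /= sum_a; congr (_ + _).
by rewrite -[RHS](sum_delta v (fun=> 1)); apply: eq_bigr => u _; rewrite mulr1.
Qed.
Let notin_cnbr v u : (u \notin cnbr v)%:R = 1 - e v u.
Proof.
rewrite inE /e /a eq_sym; case: eqP => [->|_] /=; first by rewrite adj_irrefl.
by case: adj.
Qed.
Let sum1 : \sum_(u : G) (1 : int) = #|G|%:R.
Proof. by rewrite sumr_const. Qed.

Let sum_ee v u : \sum_w e v w * e u w = (v == u)%:R + a v u *+ 2 + \sum_w a v w * a u w.
Proof.
under eq_bigr => w _ do rewrite mulrDl.
rewrite big_split /= sum_delta /e.
under eq_bigr => w _ do rewrite mulrDr.
rewrite big_split /=.
under eq_bigr => w _ do rewrite mulrC.
by rewrite sum_delta eq_sym [a u v]aC; ring.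
Qed.

(** The diagonal of the cube of I + A. *)
Let sum_eee v : \sum_u e v u * (\sum_w e v w * e u w) = 1 + (deg v)%:Z * 3 + (tri v)%:Z.
Proof.
have a0 : a v v = 0 by rewrite /a adj_irrefl.
have aa u : a v u * a v u = a v u by rewrite /a; case: adj.
under eq_bigr => u _ do rewrite sum_ee mulrDl.
rewrite big_split /= sum_delta eqxx a0 mul0rn addr0.
under eq_bigr => w _ do rewrite aa.
rewrite sum_a.
have -> : \sum_u a v u * ((v == u)%:R + a v u *+ 2 + \sum_w a v w * a u w) =
    (deg v)%:Z *+ 2 + (tri v)%:Z.
  rewrite -sum_a -sumrMnl /tri -natz natr_sum -big_split /=.
  apply: eq_bigr => u _; rewrite natr_sum.
  have au0 : a v u * (v == u)%:R = 0.
    by case: eqP => [<-|]; rewrite ?mulr0 // a0 mul0r.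
  rewrite !mulrDr !aa au0 add0r mulr_sumr; congr (_ + _).
  by apply: eq_bigr => w _; rewrite /a -!natrM !mulnb.
by rewrite /=; ring.
Qed.

(** The left side counts ordered triples, weighted by the product of [1 - e v u], [1 - e v w] and
    [1 - e u w]. Expanding the product gives the four terms, the last being the trace of the cube of
    I + A. *)
Lemma coef3_wtT :
  (wt 'X [set: G] : {poly int})`_3 *+ 6 = #|G|%:R ^+ 3
    - #|G|%:R * 3 * \sum_v (1 + (deg v)%:Z)
    + 3 * \sum_v (1 + (deg v)%:Z) ^+ 2
    - \sum_v (1 + (deg v)%:Z * 3 + (tri v)%:Z).
Proof.
set n : int := #|G|%:R; pose S := \sum_v s v.
have sum_c (c : int) : \sum_(u : G) c = n * c.
  by rewrite /n -sum1 mulr_suml; apply: eq_bigr => u _; rewrite mul1r.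
have nat_sum (A : {set G}) : #|A|%:R = \sum_w (w \in A)%:R :> int.
  by rewrite -sum1_card natr_sum big_mkcond; apply: eq_bigr => w _; case: (w \in A).
have inner v u : #|[set: G] :\: cnbr v :\: cnbr u|%:R =
    n - s v - s u + \sum_w e v w * e u w.
  rewrite nat_sum -!sum_e /n -sum1 -!sumrB -big_split /=; apply: eq_bigr => w _.
  by rewrite 2!in_setD in_setT andbT -mulnb natrM !notin_cnbr; ring.
have exch : \sum_v \sum_u e v u * s u = \sum_u s u ^+ 2.
  rewrite exchange_big; apply: eq_bigr => u _ /=.
  by rewrite -mulr_suml -sum_e expr2; congr (_ * _); apply: eq_bigr => v _; rewrite eC.
have exch3 v : \sum_u \sum_w e v w * e u w = \sum_u e v u * s u.
  rewrite exchange_big; apply: eq_bigr => w _ /=.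
  by rewrite -mulr_sumr -sum_e; congr (_ * _); apply: eq_bigr => u _; rewrite eC.
have middle v : \sum_(u in [set: G] :\: cnbr v) #|[set: G] :\: cnbr v :\: cnbr u|%:R =
   n * (n - s v) - S + (\sum_u e v u * s u) *+ 2 - s v * (n - s v)
   - (1 + (deg v)%:Z * 3 + (tri v)%:Z).
  (* The restriction on [u] becomes the factor [1 - e v u], so that all sums run over the whole
     vertex set. *)
  rewrite big_mkcond /= (eq_bigr (fun u => ((n - s v) - s u + \sum_w e v w * e u w)
     - (e v u * (n - s v) - e v u * s u + e v u * \sum_w e v w * e u w))); last first.
    move=> u _; rewrite in_setD in_setT andbT inner.
    have -> : e v u = 1 - (u \notin cnbr v)%:R by rewrite notin_cnbr; ring.
    by case: (u \notin cnbr v) => /=; ring.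
  rewrite sumrB !big_split /= !sumrN sum_eee exch3 -mulr_suml sum_e.
  by rewrite !sum_c -/S; ring.
rewrite coef3_wt (eq_bigr _ (fun v _ => middle v)).
rewrite (eq_bigl predT) => [|v]; last by rewrite inE.
pose y v := 1 + (deg v)%:Z * 3 + (tri v)%:Z.
rewrite (eq_bigr (fun v => n * n + (- S) + (- (n * 2)) * s v + s v ^+ 2
  + 2 * (\sum_u e v u * s u) + (-1) * y v)) => [|v _]; last by rewrite /y; ring.
rewrite -/(\sum_v s v) -/(\sum_v s v ^+ 2) -/(\sum_v y v) -/S.
set Q := \sum_v s v ^+ 2; set Y := \sum_v y v.
rewrite !big_split /= !sum_c -!mulr_sumr exch -/S -/Q -/Y; ring.
Qed.
End Triples.
End Degrees.

(** * Connected components and their edges *)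

Section Component.
Variable G : sgraph.
Implicit Types (u v w : G) (S W : {set G}).

Definition component (r : G) : {set G} := [set v | connect (@adj G) r v].
Definition arcs S : nat := \sum_(u in S) \sum_(v in S) adj u v.

Lemma component_closed r : closed (@adj G) (mem (component r)).
Proof.
move=> u v uv; rewrite !inE.
exact: (connect_closed (sym_connect_sym (@adj_sym G))).
Qed.

Lemma component_sub r S : closed (@adj G) (mem S) -> r \in S -> component r \subset S.
Proof.
move=> clS rS; apply/subsetP => v; rewrite inE => rv.
by rewrite -(closed_connect clS rv).
Qed.

Lemma componentP r u v : u \in component r -> v \in component r -> connect (@adj G) u v.
Proof.
rewrite !inE => ru; apply: connect_trans.
by rewrite (sym_connect_sym (@adj_sym G)).
Qed.

(** A nonempty part of a component that no edge leaves is closed, hence is the whole component; so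
    the component is reached from [S] one vertex at a time. *)
Lemma component_ind r (P : {set G} -> Prop) S :
    S != set0 -> S \subset component r -> P S ->
    (forall (T : {set G}) u v, u \in T -> v \notin T -> adj u v -> P T -> P (v |: T)) ->
  P (component r).
Proof.
move=> + + + PU; have [m] := ubnP #|component r :\: S|.
elim: m S => // m IHm S leSm S0 SK PS.
have [KS|/subsetPn[w wK wS]] := boolP (component r \subset S).
  by have <- : S = component r by apply/eqP; rewrite eqEsubset SK.
have [/existsP[u /existsP[v /and3P[uS vS uv]]]|no] :=
  boolP [exists u, exists v, [&& u \in S, v \notin S & adj u v]]; last first.
  have clS : closed (@adj G) (mem S).
    apply: (intro_closed (sym_connect_sym (@adj_sym G))) => u v uv /= uS; apply: contraR no => vS.
    by apply/existsP; exists u; apply/existsP; exists v; rewrite uS vS.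
  have /set0Pn[s sS] := S0.
  case/negP: wS.
  by rewrite -(closed_connect clS (componentP (subsetP SK _ sS) wK)).
have vK : v \in component r by have /= <- := component_closed r uv; apply: (subsetP SK).
apply: (IHm (v |: S)).
- rewrite -ltnS (leq_trans _ leSm) // ltnS; apply: proper_card.
  apply/properP; split; first by apply: setDS; apply: subsetUr.
  by exists v; rewrite !in_setD ?vS ?vK // in_setU1 eqxx.
- by apply/set0Pn; exists v; rewrite !inE eqxx.
- by rewrite subUset sub1set vK.
- exact: PU uS vS uv PS.
Qed.

Lemma arcsU1 v S : v \notin S ->
  arcs (v |: S) = arcs S + 2 * \sum_(u in S) adj v u.
Proof.
move=> vS; rewrite /arcs big_setU1 //= big_setU1 //= adj_irrefl add0n.
under [X in _ + X]eq_bigr => u _ do rewrite big_setU1 //= adj_sym.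
by rewrite big_split /=; lia.
Qed.

Lemma arcs_closed S : closed (@adj G) (mem S) -> arcs S = \sum_(v in S) deg v.
Proof.
move=> clS; apply: eq_bigr => u uS; rewrite /deg [RHS](bigID (mem S)) /=.
rewrite [X in _ + X]big1 ?addn0 // => v vS.
by case: (boolP (adj u v)) => // /clS /=; rewrite uS (negbTE vS).
Qed.

(** Each vertex added to the growing set brings at least one new edge; trees give equality. *)
Lemma component_deg_sum r : 2 * #|component r| <= \sum_(v in component r) deg v + 2.
Proof.
rewrite -arcs_closed; last exact: component_closed.
apply: (component_ind (r := r) (P := fun S => 2 * #|S| <= arcs S + 2) (S := [set r])).
- by apply/set0Pn; exists r; rewrite inE.
- by rewrite sub1set inE.
- by rewrite cards1; lia.
move=> T u v uT vT uv; rewrite cardsU1 vT arcsU1 //.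
by rewrite (bigD1 u) //= [adj v u]adj_sym uv; lia.
Qed.

(* A spanning tree grown from a triangle uses up all the edges, so each new
   vertex has a single neighbour in the part already reached. *)
Lemma unicyclic_triangle r a b c x y z :
    \sum_(v in component r) deg v = 2 * #|component r| ->
    a \in component r -> adj a b -> adj b c -> adj a c ->
    x \in component r -> adj x y -> adj x z -> adj y z ->
  x \in [set a; b; c].
Proof.
move=> hdeg aK ab bc ac xK xy xz yz; set S0 := [set a; b; c].
have cl := @component_closed r.
have bK : b \in component r by rewrite -(cl _ _ ab).
have cK : c \in component r by rewrite -(cl _ _ ac).
have yK : y \in component r by rewrite -(cl _ _ xy).
have zK : z \in component r by rewrite -(cl _ _ xz).
have ne u v : adj u v -> u != v by apply: contraTneq => ->; rewrite adj_irrefl.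
(* The invariant of the growth: there are at least as many edges as vertices, and in case of
   equality every triangle so far has its vertices in [S0]. *)
pose P (S : {set G}) := 2 * #|S| <= arcs S /\ (arcs S = 2 * #|S| ->
  {in S & &, forall x y z, adj x y -> adj x z -> adj y z -> x \in S0}).
suff [_ PK] : P (component r) by apply: (PK _ x y z) => //; rewrite arcs_closed.
apply: (component_ind (S := S0)).
- by apply/set0Pn; exists a; rewrite !inE eqxx.
- by rewrite !subUset !sub1set aK bK cK.
- split; last by move=> _ x1 y1 z1.
  have S0E : S0 = a |: (b |: [set c]) by rewrite /S0 setUA.
  have ba := ne _ _ ab; have ca := ne _ _ ac; have cb := ne _ _ bc.
  rewrite S0E arcsU1 ?inE ?negb_or ?ba ?ca // arcsU1 ?inE // big_setU1 ?inE //=.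
  rewrite !big_set1 ab bc ac !cardsU1 cards1 !inE negb_or ba ca cb.
  by rewrite /arcs !big_set1 adj_irrefl.
move=> T u v uT vT uv [le tT]; have vu : adj v u by rewrite adj_sym.
have := arcsU1 vT; rewrite (bigD1 u) //= vu.
set m := \sum_(i in T | i != u) adj v i => hm.
rewrite /P cardsU1 vT hm; split; first by clear -le; lia.
move=> eq; have eT : arcs T = 2 * #|T| by clear -le eq; lia.
have m0 : m = 0 by clear -eT eq; lia.
(* Since [m = 0], the only neighbour of [v] in [T] is [u], so no triangle of the enlarged set passes
   through [v]. *)
have one w : w \in T -> adj v w -> w = u.
  move=> wT vw; apply/eqP; apply: contraTT vw => wu.
  by move/eqP: m0; rewrite sum_nat_eq0 => /forall_inP/(_ w); rewrite wT wu eqb0; apply.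
move=> x1 y1 z1 /setU1P[->|xT] /setU1P[->|yT] /setU1P[->|zT]; rewrite ?adj_irrefl //.
- by move=> /(one _ yT) -> /(one _ zT) ->; rewrite adj_irrefl.
- by rewrite adj_sym => h1 + h2; rewrite (one _ xT h1) (one _ zT h2) adj_irrefl.
- by move=> + h1 h2; rewrite adj_sym in h1; rewrite adj_sym in h2;
     rewrite (one _ xT h1) (one _ yT h2) adj_irrefl.
- exact: (tT eT) x1 y1 z1 xT yT zT.
Qed.

End Component.

(** * Triangles and degree excess in a unicyclic component *)

Lemma sum_Posz (I : finType) (P : pred I) (F : I -> nat) :
  (\sum_(i | P i) (F i)%:Z = (\sum_(i | P i) F i)%N%:Z)%R.
Proof. by rewrite -natz natr_sum; apply: eq_bigr => i _; rewrite natz. Qed.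

Section Unicyclic.
Variables (G : sgraph) (r : G).
Local Notation K := (component r).
Implicit Types u v w : G.

Lemma adj_neq u v : adj u v -> u != v.
Proof. by apply: contraTneq => ->; rewrite adj_irrefl. Qed.

Lemma adj_comp u v : adj u v -> u \in K -> v \in K.
Proof. by move=> /(@component_closed _ r) /= ->. Qed.

Lemma tri_witness : 0 < \sum_(v in K) tri v ->
  exists a b c, [/\ a \in K, adj a b, adj b c & adj a c].
Proof.
rewrite lt0n sum_nat_eq0 negb_forall_in => /exists_inP[a aK].
rewrite sum_nat_eq0 negb_forall_in => /exists_inP[b _].
rewrite sum_nat_eq0 negb_forall_in => /exists_inP[c _].
by rewrite eqb0 negbK => /and3P[ab ac bc]; exists a, b, c.
Qed.

Hypothesis hdeg : \sum_(v in K) deg v = 2 * #|K|.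

(** All triangles have their vertices in one set [S] of size 3, and each vertex of [S] sees at most
    two ordered pairs in it. *)
Lemma sum_tri_le : \sum_(v in K) tri v <= 6.
Proof.
have [->//|] := posnP (\sum_(v in K) tri v).
case/tri_witness => a [b [c [aK ab bc ac]]]; set S := [set a; b; c].
have inS x y z : x \in K -> adj x y -> adj x z -> adj y z -> x \in S.
  exact: unicyclic_triangle hdeg aK ab bc ac.
have cardS : #|S| = 3.
  by rewrite /S setUC cardsU1 cards2 !inE (eq_sym c) (eq_sym c)
             (negbTE (adj_neq ac)) (negbTE (adj_neq bc)) (negbTE (adj_neq ab)).
have tri0 v : v \in K -> tri v != 0 -> v \in S.
  move=> vK; rewrite sum_nat_eq0 negb_forall_in => /exists_inP[u _].
  rewrite sum_nat_eq0 negb_forall_in => /exists_inP[w _].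
  by rewrite eqb0 negbK => /and3P[vu vw uw]; apply: inS vK vu vw uw.
have tri2 v : v \in K -> v \in S -> tri v <= 2.
  move=> vK vS; apply: (@leq_trans (\sum_(u in S :\ v) \sum_(w in S :\ v :\ u) 1)).
    rewrite [leqRHS]big_mkcond; apply: leq_sum => u _.
    case: ifP => uS; last first.
      rewrite leqn0 sum_nat_eq0; apply/forall_inP => w _; rewrite eqb0.
      apply: contraFN uS => /and3P[vu vw uw]; rewrite !inE eq_sym adj_neq //=.
      by have := inS u v w (adj_comp vu vK); rewrite !inE adj_sym; apply.
    rewrite [leqRHS]big_mkcond; apply: leq_sum => w _.
    case: ifP => wS; first by case: andP.
    rewrite leqn0 eqb0; apply: contraFN wS => /and3P[vu vw uw].
    rewrite !inE eq_sym (adj_neq uw) eq_sym (adj_neq vw) /=.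
    have := inS w v u (adj_comp vw vK); rewrite !inE adj_sym => -> //.
    by rewrite adj_sym.
  have cv : #|S :\ v| = 2 by have := cardsD1 v S; rewrite vS cardS; lia.
  rewrite (eq_bigr (fun=> 1)); first by rewrite sum1_card cv.
  by move=> u uS; rewrite sum1_card; have := cardsD1 u (S :\ v); rewrite uS cv; lia.
apply: (@leq_trans (\sum_(v in S) 2)); last by rewrite sum_nat_const cardS.
rewrite big_mkcond [leqRHS]big_mkcond; apply: leq_sum => v _.
case: ifP => // vK; case: ifP => vS; first exact: tri2.
by rewrite leqn0; apply: contraFT vS; apply: tri0.
Qed.

Local Open Scope ring_scope.

Definition exc v : int := (deg v)%:Z - 2.

Lemma sum_exc : \sum_(v in K) exc v = 0.
Proof.
by rewrite sumrB sumr_const sum_Posz hdeg -mulr_natl; lia.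
Qed.

(** The excess sums to 0, so adding it to the squares or subtracting it keeps their sum. Both
    [e ^+ 2 + e] and [e ^+ 2 - e] are nonnegative at integers, and for a suitable sign the term at
    [v] is at least 2. *)
Lemma exc_pos v : v \in K -> exc v != 0 -> 2 <= \sum_(v in K) exc v ^+ 2.
Proof.
move=> vK v0; have h0 := sum_exc.
have hp : \sum_(u in K) (exc u ^+ 2 + exc u) = \sum_(u in K) exc u ^+ 2.
  by rewrite big_split /= h0 addr0.
have hm : \sum_(u in K) (exc u ^+ 2 - exc u) = \sum_(u in K) exc u ^+ 2.
  by rewrite sumrB h0 subr0.
case: (ltrgtP (exc v) 0) v0 => // v0 _.
- rewrite -hm (bigD1 v) //= -[2]addr0 lerD //; first by nia.
  by apply: sumr_ge0 => u _; nia.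
- rewrite -hp (bigD1 v) //= -[2]addr0 lerD //; first by nia.
  by apply: sumr_ge0 => u _; nia.
Qed.

(** With all degrees equal to 2, no edge leaves the triangle, so it is the whole component. *)
Lemma regular_triangle_card a b c : {in K, forall v, deg v = 2%N} ->
  a \in K -> adj a b -> adj b c -> adj a c -> (#|K| <= 3)%N.
Proof.
move=> deg2 aK ab bc ac.
have nb x y z : x \in K -> adj x y -> adj x z -> y != z ->
    forall u, adj x u -> u \in [set y; z].
  move=> xK xy xz yz u xu.
  suff -> : [set y; z] = [set u | adj x u] by rewrite inE.
  apply/eqP; rewrite eqEcard cards2 yz -degE deg2 // leqnn andbT.
  by apply/subsetP => w; rewrite !inE => /orP[]/eqP->.
have clS : closed (@adj G) (mem [set a; b; c]).
  apply: (intro_closed (sym_connect_sym (@adj_sym G))) => x y xy.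
  have [ba cb ca] : [/\ adj b a, adj c b & adj c a] by rewrite ![adj _ a]adj_sym [adj c b]adj_sym.
  rewrite /= !inE -orbA => /or3P[]/eqP xE; rewrite xE in xy.
  - by have := nb _ _ _ aK ab ac (adj_neq bc) _ xy; rewrite !inE => /orP[]->; rewrite ?orbT.
  - have := nb _ _ _ (adj_comp ab aK) ba bc (adj_neq ac) _ xy.
    by rewrite !inE => /orP[]->; rewrite ?orbT.
  - have := nb _ _ _ (adj_comp ac aK) ca cb (adj_neq ab) _ xy.
    by rewrite !inE => /orP[]->; rewrite ?orbT.
have KS : K \subset [set a; b; c].
  apply/subsetP => v vK; rewrite -(closed_connect clS (componentP aK vK)).
  by rewrite !inE eqxx.
apply: leq_trans (subset_leq_card KS) _.
by rewrite setUC cardsU1 cards2; case: (_ \notin _); case: (_ == _).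
Qed.

(** If there is a triangle, [K] is not 2-regular, so the squares sum to at least 2, while the left
    side is at most 6. *)
Lemma sum_tri_le_exc : (3 < #|K|)%N ->
  \sum_(v in K) (tri v)%:Z <= \sum_(v in K) 3 * exc v ^+ 2.
Proof.
move=> K3; rewrite -mulr_sumr.
rewrite sum_Posz.
have Q0 : 0 <= \sum_(v in K) exc v ^+ 2 by apply: sumr_ge0 => v _; apply: sqr_ge0.
have [->|tri_gt0] := posnP (\sum_(v in K) tri v)%N; first by rewrite mulr_ge0.
have t6 := sum_tri_le.
have [a [b [c [aK ab bc ac]]]] := tri_witness tri_gt0.
have [/forall_inP all2|] := boolP [forall v in K, exc v == 0].
  have := @regular_triangle_card a b c _ aK ab bc ac; rewrite leqNgt K3.
  suff h : {in K, forall v, deg v = 2%N} by move=> /(_ h).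
  by move=> v /all2 /eqP; rewrite /exc; lia.
rewrite negb_forall_in => /exists_inP[v vK v0].
by have := exc_pos vK v0; lia.
Qed.

End Unicyclic.

(** * The shape of a unicyclic component that attains equality *)

Lemma maximal_path (G : sgraph) (x0 : G) : exists y s,
  [/\ path (@adj G) y s, uniq (y :: s), last y s = x0 &
      forall u, adj y u -> u \in y :: s].
Proof.
suff main m y s : #|G| - size s <= m -> path (@adj G) y s -> uniq (y :: s) ->
    last y s = x0 -> exists y s, [/\ path (@adj G) y s, uniq (y :: s),
      last y s = x0 & forall u, adj y u -> u \in y :: s].
  by apply: (main _ x0 [::] (leqnn _)).
elim: m y s => [|m IHm] y s le_m pys uys lys.
  have : size s < #|G| by rewrite -[(size s).+1](card_uniqP uys) max_card.
  by rewrite -subn_gt0 ltnNge le_m.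
(* A neighbour of [y] off the path would extend it at the head, leaving the last vertex [x0] in
   place. *)
have [/forall_inP all_in|] := boolP [forall u in adj y, u \in y :: s].
  by exists y, s.
rewrite negb_forall_in => /exists_inP[u] yu us.
apply: (IHm u (y :: s)) => //=; first by rewrite subnS; move: le_m; case: (_ - _).
  by rewrite adj_sym; apply/andP.
by rewrite us.
Qed.

Section UnicyclicStructure.
Variables (G : sgraph) (r : G).
Local Notation K := (component r).
Hypothesis hdeg : \sum_(v in K) deg v = 2 * #|K|.
Hypothesis K_gt3 : 3 < #|K|.
Hypothesis htri :
  (\sum_(v in K) (tri v)%:Z = \sum_(v in K) 3 * exc v ^+ 2)%R.

Let exc2_le : (\sum_(v in K) exc v ^+ 2 <= 2)%R.
Proof.
have := sum_tri_le hdeg; move: htri; rewrite sum_Posz -mulr_sumr; lia.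
Qed.

(** For either sign the summands are nonnegative integers with total at most 2. This forces every
    excess to be -1, 0 or 1, with 1 and -1 each taken at most once. *)
Let pronic_le (e : int) : (e = 1 \/ e = -1)%R ->
  (\sum_(v in K) (exc v ^+ 2 + e * exc v) <= 2)%R.
Proof. by rewrite big_split /= -mulr_sumr (sum_exc hdeg) mulr0 addr0. Qed.

Let pronic_ge0 (e x : int) : (e = 1 \/ e = -1)%R -> (0 <= x ^+ 2 + e * x)%R.
Proof. by case=> ->; nia. Qed.

Let pronic1 (e : int) v : (e = 1 \/ e = -1)%R -> v \in K ->
  (exc v ^+ 2 + e * exc v <= 2)%R.
Proof.
move=> he vK; apply: le_trans (pronic_le he); rewrite (bigD1 v) //= lerDl.
by apply: sumr_ge0 => u _; apply: pronic_ge0.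
Qed.

Let pronic2 (e : int) u v : (e = 1 \/ e = -1)%R -> u \in K -> v \in K -> u != v ->
  (exc u ^+ 2 + e * exc u + (exc v ^+ 2 + e * exc v) <= 2)%R.
Proof.
move=> he uK vK uv; apply: le_trans (pronic_le he).
rewrite (bigD1 u) //= (bigD1 v) /=; last by rewrite vK eq_sym.
by rewrite [leRHS]addrA lerDl; apply: sumr_ge0 => w _; apply: pronic_ge0.
Qed.

Lemma deg_bounds v : v \in K -> 1 <= deg v <= 3.
Proof.
move=> vK; have := pronic1 (or_introl erefl) vK.
have := pronic1 (or_intror erefl) vK; rewrite /exc; nia.
Qed.

Lemma leaf_uniq u v : u \in K -> v \in K -> deg u = 1 -> deg v = 1 -> u = v.
Proof.
move=> uK vK du dv; apply/eqP; apply: contraT => uv.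
by have := pronic2 (or_intror erefl) uK vK uv; rewrite /exc du dv.
Qed.

Lemma deg3_uniq u v : u \in K -> v \in K -> deg u = 3 -> deg v = 3 -> u = v.
Proof.
move=> uK vK du dv; apply/eqP; apply: contraT => uv.
by have := pronic2 (or_introl erefl) uK vK uv; rewrite /exc du dv.
Qed.

(** If some excess is nonzero, the squares have a positive sum, which yields a triangle; and as the
    excess sums to 0, it is negative at some vertex, which is then a leaf. *)
Lemma regular_or_leaf : {in K, forall v, deg v = 2} \/
  (exists2 x, x \in K & deg x = 1) /\
  exists a b c, [/\ a \in K, adj a b, adj b c & adj a c].
Proof.
have [/forall_inP all2|] := boolP [forall v in K, exc v == 0%R].
  by left=> v /all2 /eqP; rewrite /exc; lia.
rewrite negb_forall_in => /exists_inP[v vK v0]; right; split; last first.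
  apply: tri_witness; have := exc_pos hdeg vK v0.
  by move: htri; rewrite sum_Posz -mulr_sumr; lia.
have [/existsP[x /andP[xK /eqP dx]]|no] := boolP [exists x, (x \in K) && (deg x == 1)].
  by exists x.
have exc0 u : u \in K -> (0 <= exc u)%R.
  move=> uK; have := deg_bounds uK; have : deg u != 1.
    by apply: contra no => du; apply/existsP; exists u; rewrite uK.
  by rewrite /exc; lia.
by have /eqP := sum_exc hdeg; rewrite psumr_eq0 // => /allP/(_ v (mem_index_enum _));
  rewrite vK (negbTE v0).
Qed.

(* A maximal path starting at a vertex of minimal degree ends at a vertex which
   has a second neighbour on it; counting degrees, this closing edge and the
   edges of the path are all the edges at its vertices. *)
Lemma unicyclic_lolli : exists k f,
  [/\ k = 2 \/ k = #|K|.-1, lolli_enum #|K| k f & K = seg #|K| f predT].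
Proof.
(* The far end [x0] of the path is the leaf if there is one, and [r] otherwise. *)
have [x0 [x0K hx0]] : exists x0, x0 \in K /\
    ({in K, forall v, deg v = 2} \/
     deg x0 = 1 /\ exists a b c, [/\ a \in K, adj a b, adj b c & adj a c]).
  case: regular_or_leaf => [h|[[x xK dx] h]]; last by exists x; split=> //; right.
  by exists r; split; [rewrite inE|left].
have [y [s [pys uys lys max_s]]] := maximal_path x0.
set t := y :: s in uys max_s; set n := size t; pose f i := nth y t i.
have clK := @component_closed _ r.
have fadj i : i.+1 < n -> adj (f i) (f i.+1).
  by move=> hi; apply: (pathP y pys).
have fx0 : f n.-1 = x0 by rewrite -lys (last_nth y).
have fin i : i < n -> f i \in t by move=> hi; apply: mem_nth.
have finj i j : i < n -> j < n -> f i = f j -> i = j.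
  by move=> hi hj /eqP; rewrite nth_uniq // => /eqP.
have tK : {subset t <= K}.
  move=> v vt; have yv : connect (@adj G) y v.
    apply: (connect_trans (y := v)) (connect0 _ _).
    by case/splitPl: vt pys => p1 p2 <-; rewrite cat_path => /andP[p _]; apply/connectP; exists p1.
  have yx0 : connect (@adj G) y x0 by apply/connectP; exists s.
  have yK : y \in K by rewrite (closed_connect clK yx0).
  by rewrite -(closed_connect clK yv).
have fK i : i < n -> f i \in K by move=> /fin /tK.
have n_gt0 : 0 < n by [].
have fidx v : v \in t -> exists2 i, i < n & v = f i.
  by move=> vt; exists (index v t); rewrite ?index_mem // /f nth_index.
have [w yw] : exists w, adj y w.
  have := deg_bounds (fK 0 n_gt0); rewrite degE => /andP[/card_gt0P[w]].
  by rewrite inE; exists w.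
have n_gt1 : 1 < n.
  have [i hi wi] := fidx w (max_s _ yw); rewrite wi in yw.
  by case: i hi wi yw => [|i] hi _; rewrite ?adj_irrefl //; lia.
(* The path has at least two vertices, so [y] differs from [x0], and only [x0] can be a leaf. *)
have degy : 2 <= deg y.
  case: hx0 => [h|[dx0 _]]; first by rewrite h // (fK 0).
  have := deg_bounds (fK 0 n_gt0); rewrite -[f 0]/y => /andP[].
  rewrite leq_eqVlt => /predU1P[dy|//].
  have yx : y = x0 by apply: leaf_uniq => //; apply: (fK 0).
  have n1 : n.-1 < n by lia.
  by have := finj 0 n.-1 n_gt0 n1; rewrite fx0 -yx => /(_ erefl); lia.
have [k k_bd yk] : exists2 k, 2 <= k < n & adj y (f k).
  have : ~~ ([set u | adj y u] \subset [set f 1]).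
    by apply/negP => /subset_leq_card; rewrite -degE cards1; lia.
  case/subsetPn => u; rewrite !inE => yu u1.
  have [i hi ui] := fidx u (max_s _ yu); exists i; last by rewrite -ui.
  case: i hi ui => [|[|i]] //= hi ui.
    by rewrite ui adj_irrefl in yu.
  by rewrite ui eqxx in u1.
have nE : size t = n by []; clearbody n.
(* The neighbours of the index [i] along the closed-up path as an explicit list, whose length is to
   be compared with [deg (f i)]. *)
pose nb i : seq nat := if i == 0 then [:: 1; k]
  else if i == n.-1 then n.-2 :: (if k == n.-1 then [:: 0] else [::])
  else i.-1 :: i.+1 :: (if i == k then [:: 0] else [::]).
have nbE i j : i < n -> j < n ->
    (j \in nb i) = (lolli_edge k i j || lolli_edge k j i).
  move=> hi hj; rewrite /nb /lolli_edge.
  by do 3?[case: ifP => ?]; rewrite !inE; lia.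
have nb_lt i j : i < n -> j \in nb i -> j < n.
  move=> hi; rewrite /nb.
  by do 3?[case: ifP => ?]; rewrite !inE; lia.
have nb_uniq i : i < n -> uniq (nb i).
  move=> hi; rewrite /nb.
  by do 3?[case: ifP => ?]; rewrite /= ?inE; lia.
have nb_adj i j : i < n -> j \in nb i -> adj (f i) (f j).
  move=> hi hji; have hj := nb_lt _ _ hi hji; move: hji.
  have e a b : b < n -> lolli_edge k a b -> adj (f a) (f b).
    by move=> hb /orP[/eqP ab|/andP[/eqP-> /eqP->//]]; rewrite ab in hb *; apply: fadj.
  by rewrite nbE // => /orP[/(e _ _ hj)//|/(e _ _ hi)]; rewrite adj_sym.
pose nbf i := [set v in map f (nb i)].
have card_nbf i : i < n -> #|nbf i| = size (nb i).
  move=> hi; rewrite cardsE -(size_map f); apply/card_uniqP.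
  rewrite map_inj_in_uniq ?nb_uniq // => a b /(nb_lt _ _ hi) ha /(nb_lt _ _ hi) hb.
  exact: finj.
have nbf_sub i : i < n -> nbf i \subset [set u | adj (f i) u].
  by move=> hi; apply/subsetP => u; rewrite !inE => /mapP[j /(nb_adj _ _ hi) h ->].
have size_le i : i < n -> size (nb i) <= deg (f i).
  by move=> hi; rewrite -card_nbf // degE subset_leq_card // nbf_sub.
(* If the path closes up at its far end, all degrees are 2. Otherwise [f k] has three neighbours, so
   it is the only vertex of degree 3, and [x0] is the leaf. *)
have deg_le i : i < n -> deg (f i) <= size (nb i).
  move=> hi; have [k_last|k_last] := eqVneq k n.-1.
    have := size_le n.-1; rewrite fx0.
    case: hx0 => [h _|[dx0 _]].
      by rewrite h ?fK // /nb; do 3?[case: ifP => ?]; rewrite //=; lia.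
    by rewrite dx0 /nb; do 3?[case: ifP => ?]; rewrite //=; lia.
  have kn : k < n by lia.
  have szk : size (nb k) = 3 by rewrite /nb; do 3?[case: ifP => ?]; rewrite //=; lia.
  case: hx0 => [h|[dx0 _]].
    by have := size_le k kn; rewrite szk h // fK.
  have dk : deg (f k) = 3 by have := size_le k kn; have := deg_bounds (fK k kn); lia.
  have [->|ik] := eqVneq i k; first by rewrite dk szk.
  have [->|il] := eqVneq i n.-1.
    by rewrite fx0 dx0 /nb; do 3?[case: ifP => ?]; rewrite //=; lia.
  have d3 : deg (f i) != 3.
    apply: contra ik => /eqP di; apply/eqP; apply: finj => //.
    by apply: deg3_uniq; rewrite ?fK.
  have := deg_bounds (fK i hi).
  by rewrite /nb; do 3?[case: ifP => ?]; rewrite //=; lia.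
have nbfE i u : i < n -> adj (f i) u = (u \in nbf i).
  move=> hi; have /eqP-> : nbf i == [set u | adj (f i) u]; last by rewrite inE.
  by rewrite eqEcard nbf_sub // card_nbf // -degE deg_le.
have fE i j : i < n -> j < n -> adj (f i) (f j) = lolli_edge k i j || lolli_edge k j i.
  move=> hi hj; rewrite nbfE // inE -nbE //.
  apply/mapP/idP => [[l hl /finj e]|hl]; last by exists j.
  by rewrite e // (nb_lt _ _ hi hl).
(* The path is now known to be closed under adjacency, so it fills the component. *)
have KE : K = [set v in t].
  apply/eqP; rewrite eqEsubset; apply/andP; split; last first.
    by apply/subsetP => v; rewrite inE => /tK.
  apply/subsetP => v vK.
  have clt : closed (@adj G) (mem [set v in t]).
    apply: (intro_closed (sym_connect_sym (@adj_sym G))) => u w' uw /=.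
    rewrite !inE => /fidx [i hi ui]; move: uw; rewrite ui nbfE // inE.
    by move=> /mapP[j hj ->]; apply: fin; apply: nb_lt hi hj.
  rewrite -(closed_connect clt (componentP (fK 0 n_gt0) vK)) inE.
  exact: fin.
have cK : #|K| = n by rewrite KE cardsE -nE; apply/card_uniqP.
exists k, f; rewrite cK; split.
- have [|k_last] := eqVneq k n.-1; [by right|left].
  case: hx0 => [h|[_ [a [b [c [aK ab bc ac]]]]]].
    have kn : k < n by lia.
    have := size_le k kn; rewrite h ?fK //.
    by rewrite /nb; do 3?[case: ifP => ?]; rewrite //=; lia.
  have idx v : v \in K -> exists2 i, i < n & v = f i.
    by rewrite KE inE => /fidx.
  have [i hi ai] := idx a aK.
  have [j hj bj] := idx b (adj_comp ab aK).
  have [l hl cl] := idx c (adj_comp ac aK).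
  (* Three indices can form a triangle only through the closing edge, and then [k = 2]. *)
  move: ab bc ac; rewrite ai bj cl !fE // /lolli_edge; lia.
- by split=> i j hi hj; [apply: finj | apply: fE].
- rewrite KE; apply/setP => v; rewrite inE; apply/idP/imsetP => [|[i _ ->]].
    by move=> /fidx [i hi ->]; exists (Ordinal hi); rewrite ?inE.
  exact: fin (ltn_ord i).
Qed.
End UnicyclicStructure.

(** * Recognising C_n and D_n up to isomorphism *)

Definition is_lolli (G : sgraph) (n k : nat) : Prop :=
  exists2 f : nat -> G, lolli_enum n k f & [set: G] = seg n f predT.

Section Isomorphism.
Implicit Types (G H : sgraph) (n k : nat).

Lemma seg_coverP G n (f : nat -> G) v :
  [set: G] = seg n f predT -> exists2 i, i < n & v = f i.
Proof.
move=> covf; have : v \in seg n f predT by rewrite -covf inE.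
by move=> /imsetP[i _ ->]; exists i.
Qed.

Lemma index_map_iota G n k (f : nat -> G) i : lolli_enum n k f -> i < n ->
  index (f i) (map f (iota 0 n)) = i.
Proof.
move=> [finj _] hi; have sz : size (map f (iota 0 n)) = n by rewrite size_map size_iota.
have nthf : nth (f 0) (map f (iota 0 n)) i = f i.
  by rewrite (nth_map 0) ?size_iota // nth_iota.
rewrite -[X in index X _]nthf index_uniq ?sz // map_inj_in_uniq ?iota_uniq //.
by move=> a b; rewrite !mem_iota /= add0n => ha hb; apply: finj.
Qed.

Lemma is_lolli_isomorphic G H n k :
  is_lolli G n k -> is_lolli H n k -> isomorphic G H.
Proof.
move=> [f fP covf] [g gP covg].
pose F v := g (index v (map f (iota 0 n))).
pose F' v := f (index v (map g (iota 0 n))).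
have FE i : i < n -> F (f i) = g i by move=> hi; rewrite /F (index_map_iota fP).
have F'E i : i < n -> F' (g i) = f i by move=> hi; rewrite /F' (index_map_iota gP).
exists F => [|u v].
  by exists F' => v; [have [i hi ->] := seg_coverP v covf; rewrite FE ?F'E
                     | have [i hi ->] := seg_coverP v covg; rewrite F'E ?FE].
have [i hi ->] := seg_coverP u covf.
have [j hj ->] := seg_coverP v covf.
by rewrite !FE // fP.2 // gP.2.
Qed.

Lemma isomorphic_is_lolli G H n k : isomorphic H G -> is_lolli G n k -> is_lolli H n k.
Proof.
move=> [F [F' FK F'K] adjF] [f fP covf]; exists (F' \o f).
  split=> i j hi hj /=; last by rewrite -adjF !F'K fP.2.
  by move=> /(can_inj F'K) /(fP.1 _ _ hi hj).
apply/setP => v; rewrite inE; apply/esym/imsetP.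
have [i hi vi] := seg_coverP (F v) covf.
by exists (Ordinal hi) => //=; rewrite -vi FK.
Qed.

Lemma ord_is_lolli n (r : rel 'I_n) r_sym r_irr k : 0 < n ->
    (forall i j : 'I_n, r i j = lolli_edge k i j || lolli_edge k j i) ->
  is_lolli (@SGraph 'I_n r r_sym r_irr) n k.
Proof.
(* Indices from [n] on are sent to 0, a default outside the range that [lolli_enum] constrains. *)
move=> n0 hr; pose f i : 'I_n := insubd (Ordinal n0) i.
have fE i : i < n -> f i = i :> nat by move=> hi; rewrite val_insubd hi.
exists f; first split=> i j hi hj.
- by move=> e; rewrite -(fE i) // -(fE j) // e.
- by rewrite /= hr !fE.
apply/setP => i; rewrite inE; apply/esym/imsetP; exists i => //.
exact: val_inj (esym (fE _ (ltn_ord i))).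
Qed.

Lemma cycle_is_lolli n : 2 < n -> is_lolli (cycle_graph n) n n.-1.
Proof.
move=> n2; apply: ord_is_lolli => [|i j]; first by lia.
have S l : l < n -> l.+1 %% n = if l == n.-1 then 0 else l.+1.
  by move=> hl; case: eqP => [->|ne]; [rewrite prednK ?modnn //; lia | rewrite modn_small //; lia].
rewrite /cycle_adj -!val_eqE /= !S ?ltn_ord // /lolli_edge.
have := ltn_ord i; have := ltn_ord j.
by do 2?[case: ifP => ?]; lia.
Qed.

Lemma D_is_lolli n : 2 < n -> is_lolli (D_graph n) n 2.
Proof.
move=> n2; apply: ord_is_lolli => [|i j]; first by lia.
by rewrite /D_adj /D_edge /lolli_edge; lia.
Qed.

Lemma wt_is_lolli (R : comNzRingType) (x : R) G n k :
  2 < n -> k = 2 \/ k = n.-1 -> is_lolli G n k -> wt x [set: G] = cycle_wt x n.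
Proof. by move=> n2 hk [f fP ->]; exact: (wt_lolli fP). Qed.

End Isomorphism.

(** * From the whole graph to its components *)

Section ComponentSums.
Variable G : sgraph.
Local Open Scope ring_scope.

(** The differences over the components are nonnegative and add up to 0, so each of them
    vanishes. *)
Lemma sum_component_eq (F1 F2 : G -> int) :
    (forall r, \sum_(v in component r) F1 v <= \sum_(v in component r) F2 v) ->
    \sum_v F1 v = \sum_v F2 v ->
  forall r, \sum_(v in component r) F1 v = \sum_(v in component r) F2 v.
Proof.
move=> le12 eq12 r; pose F v := F2 v - F1 v; pose rt := fingraph.root (@adj G).
have csym := sym_connect_sym (@adj_sym G).
have compE r' : \sum_(v | rt v == rt r') F v = \sum_(v in component r') F v.
  by apply: eq_bigl => v; rewrite inE /rt root_connect // csym.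
have ge0 q : 0 <= \sum_(v | rt v == q) F v.
  have [/existsP[r' /eqP <-]|no] := boolP [exists r', rt r' == q].
    by rewrite compE sumrB subr_ge0.
  rewrite big_pred0 // => v; apply: contraNF no => hv.
  by apply/existsP; exists v.
have /eqP : \sum_v F v = 0 by rewrite sumrB eq12 subrr.
rewrite (partition_big rt predT) //= psumr_eq0; last by move=> q _; apply: ge0.
move=> /allP/(_ (rt r) (mem_index_enum _)) /=.
by rewrite compE sumrB subr_eq0 => /eqP.
Qed.

End ComponentSums.

(** * The cycle polynomial modulo [p] *)

Section ModP.
Variables (p k : nat).
Hypothesis p_prime : prime p.
Local Open Scope ring_scope.

(** Substituting ['X ^+ 2 - 'X] turns the polynomial into the sum of the powers of ['X] and [1 - 'X]
    with exponent [p ^ k], which is 1 by Frobenius. Substitution of a nonconstant polynomial over a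
    field is injective. *)
Lemma cycle_wt_Fp : (3 < p ^ k)%N -> cycle_wt ('X : {poly 'F_p}) (p ^ k) = 1.
Proof.
move=> n3; pose q : {poly 'F_p} := 'X ^+ 2 - 'X.
have sq : size q = 3%N.
  by rewrite size_polyDl ?size_polyXn // size_polyN size_polyX.
have cw : cycle_wt 'X (p ^ k) \Po q = 1.
  have -> : cycle_wt 'X (p ^ k) \Po q = cycle_wt q (p ^ k).
    have pw m : path_wt ('X : {poly 'F_p}) m \Po q = path_wt q m /\
      path_wt ('X : {poly 'F_p}) m.+1 \Po q = path_wt q m.+1.
      elim: m => [|m [IH1 IH2]].
        by rewrite /= comp_polyD comp_polyX comp_polyC.
      by rewrite !path_wtSS comp_polyD comp_polyM comp_polyX IH1 IH2.
    by rewrite /cycle_wt comp_polyD comp_polyM comp_polyX !(pw _).1.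
  rewrite (cycle_wtE (a := 'X)) // -exprDn_pchar.
    by rewrite addrC subrK expr1n.
  by rewrite pnatX pnatE // pchar_poly pchar_Fp.
apply/eqP; rewrite -subr_eq0 -(@comp_poly_eq0 _ _ q) ?sq //.
by rewrite comp_polyB cw comp_polyC subrr.
Qed.

End ModP.

(** * Graphs with the polynomial of C_n for n a power of [p] *)

Section CycleEquivalent.
Variables (H : sgraph) (p k : nat).
Hypotheses (p_prime : prime p) (p_ge5 : 5 <= p) (k_gt0 : 0 < k).
Local Notation n := (p ^ k).
Hypothesis wtH : forall (R : comNzRingType) (x : R), wt x [set: H] = cycle_wt x n.

Let n_ge5 : 5 <= n.
Proof. by apply: leq_trans p_ge5 _; rewrite -[leqLHS]expn1 leq_exp2l //; lia. Qed.

(** Over ['F_p] the polynomial of the component divides 1, so it is constant: its coefficients of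
    degree 1 and 2 vanish, and they determine the order and then the degree sum modulo [p]. *)
Lemma component_dvd (r : H) :
  (p %| #|component r|) /\ (p %| \sum_(v in component r) deg v).
Proof.
set K := component r; pose P : {poly 'F_p} := (wt 'X K)%R.
have clK : closed (@adj H) (mem K) := @component_closed H r.
have : (P * wt 'X ([set: H] :\: K) = 1)%R.
  by rewrite -wt_closed ?subsetT // wtH cycle_wt_Fp //; lia.
move=> PQ1; have : P \is a GRing.unit.
  by apply/GRing.unitrPr; eexists; apply: PQ1.
rewrite poly_unitE => /andP[/eqP sP _].
have P1 : (P`_1 = 0)%R by rewrite nth_default ?sP.
have P2 : (P`_2 = 0)%R by rewrite nth_default ?sP.
rewrite !(dvdn_pcharf (pchar_Fp p_prime)).
move: P1 (coef2_wt_closed 'F_p clK); rewrite -/P P2 coef1_wt => -> /eqP.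
by rewrite mul0rn mul0r sub0r eq_sym oppr_eq0 eqxx.
Qed.

(** The coefficients of degree 1, 2 and 3 yield the three equations in turn. *)
Lemma cycle_equiv_counts : [/\ #|H| = n, \sum_(v : H) deg v = 2 * n &
  (\sum_(v : H) (tri v)%:Z = \sum_(v : H) 3 * exc v ^+ 2)%R].
Proof.
have [_ c1 c2 c3] := coef_cycle_wt (n := n) ltac:(lia).
have cl : closed (@adj H) (mem [set: H]) by move=> u v _; rewrite !inE.
move: (@coef1_wt H int setT) (coef2_wt_closed int cl) (coef3_wtT H).
rewrite !wtH c1 c2 c3 cardsT natz => -[cardH].
have -> : \sum_(v in [set: H]) deg v = \sum_(v : H) deg v.
  by apply: eq_bigl => v; rewrite inE.
rewrite !natz cardH => hd ht; clear c1 c2 c3.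
pose m : int := #|H|%:Z; pose D : int := (\sum_(v : H) deg v)%N%:Z.
have {}hd : (m * (m - 3) = m * (m - 1) - D)%R := hd.
have {}ht : (m * (m - 4) * (m - 5) = m ^+ 3 - m * 3 * \sum_v (1 + (deg v)%:Z)
  + 3 * (\sum_v (1 + (deg v)%:Z) ^+ 2) - \sum_v (1 + (deg v)%:Z * 3 + (tri v)%:Z))%R := ht.
have hD : (D = 2 * m)%R by clear -hd; clearbody m D; lia.
split=> //; first by apply/eqP; rewrite -eqz_nat PoszM; apply/eqP.
clear cardH wtH.
have sum1 (c : int) : (\sum_(v : H) c = m * c)%R.
  by rewrite sumr_const -mulr_natl natz.
have hs : (\sum_(v : H) (deg v)%:Z = 2 * m)%R by rewrite sum_Posz.
move: ht; rewrite !big_split /= !sum1 -!mulr_suml hs.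
have -> : (\sum_(v : H) (1 + (deg v)%:Z) ^+ 2 =
           \sum_(v : H) exc v ^+ 2 + 9 * m)%R.
  rewrite (eq_bigr (fun v => exc v ^+ 2 + 6 * (deg v)%:Z + - 3)%R); last first.
    by move=> v _; rewrite /exc; ring.
  by rewrite !big_split /= sum1 -mulr_sumr hs; ring.
rewrite -mulr_sumr; set Q := (\sum_v _)%R; set T := (\sum_v _)%R.
by clearbody Q T m => ht; lia.
Qed.

Let comp_ge5 (r : H) : 5 <= #|component r|.
Proof.
apply: leq_trans p_ge5 (dvdn_leq _ (component_dvd r).1).
by apply/card_gt0P; exists r; rewrite inE.
Qed.

(** On each component the left side is at most the right one, and the totals over [H] agree. *)
Let sumz_component_deg (r : H) :
  (\sum_(v in component r) 2%:Z = \sum_(v in component r) (deg v)%:Z)%R.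
Proof.
have [cardH degH _] := cycle_equiv_counts.
apply: sum_component_eq; last first.
  by rewrite sumr_const sum_Posz degH -cardH PoszM -mulr_natr natz mulrC.
move=> q; rewrite sumr_const sum_Posz -mulr_natr natz.
have := component_deg_sum q; have [pK pd] := component_dvd q.
set d := \sum_(v in _) _ in pd *; set m := #|_| in pK * => hd.
(* Otherwise [2 * m - d] is 1 or 2, yet divisible by [p >= 5]: the component is not a tree. *)
suff : 2 * m <= d by lia.
rewrite leqNgt; apply/negP => ltd.
have : p %| 2 * m - d by rewrite dvdn_sub // dvdn_mull.
by move=> /dvdn_leq; rewrite subn_gt0 ltd => /(_ isT); lia.
Qed.

Lemma component_deg (r : H) : \sum_(v in component r) deg v = 2 * #|component r|.
Proof.
by have := sumz_component_deg r; rewrite sumr_const sum_Posz -mulr_natr natz; lia.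
Qed.

Lemma component_lolli (r : H) : exists q f,
  [/\ q = 2 \/ q = #|component r|.-1, lolli_enum #|component r| q f &
      component r = seg #|component r| f predT].
Proof.
have K4 q : 3 < #|component (q : H)| by have := comp_ge5 q; lia.
apply: unicyclic_lolli => //; first exact: component_deg.
have [_ _ tri_exc] := cycle_equiv_counts.
by apply: sum_component_eq => // q; apply: sum_tri_le_exc (component_deg q) (K4 q).
Qed.

Local Open Scope ring_scope.
Local Notation x0 := (- (1 / 4) : rat).

(** The point [x0] is [a ^+ 2 - a] for [a = 1 / 2], where [a] and [1 - a] coincide. *)
Let cycle_wt_eval m : (3 < m)%N -> cycle_wt x0 m = 2 * (1 / 2) ^+ m.
Proof.
move=> m3; rewrite (cycle_wtE (a := 1 / 2)) //.
have -> : 1 - 1 / 2 = 1 / 2 :> rat by [].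
by ring.
Qed.

Let wt_component_eval (r : H) : wt x0 (component r) = 2 * (1 / 2) ^+ #|component r|.
Proof.
have [q [f [hq fP {1}->]]] := component_lolli r; have := comp_ge5 r => K5.
by rewrite (wt_lolli fP) // ?cycle_wt_eval //; lia.
Qed.

Let half_gt0 m : 0 < (1 / 2 : rat) ^+ m. Proof. exact: exprn_gt0. Qed.

(** Each component [K] contributes a factor [2 * (1 / 2) ^+ #|K|], and a nonempty closed set
    contains at least one; further factors 2 only increase the value. *)
Let wt_closed_eval (S : {set H}) : closed (@adj H) (mem S) -> S != set0 ->
  2 * (1 / 2) ^+ #|S| <= wt x0 S.
Proof.
have [m] := ubnP #|S|; elim: m S => // m IHm S leSm clS /set0Pn[r rS].
have KS := component_sub clS rS; set K := component r in KS.
have clK : closed (@adj H) (mem K) := @component_closed H r.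
have cS : #|S| = (#|K| + #|S :\: K|)%N by rewrite -(cardsID K S) (setIidPr KS).
have rK : r \in K by rewrite inE.
rewrite (wt_closed _ clK KS) wt_component_eval -/K cS exprD.
have [->|ne] := eqVneq (S :\: K) set0; first by rewrite cards0 wt0 expr0 !mulr1.
have lt : (#|S :\: K| < m)%N.
  have : (0 < #|K|)%N by apply/card_gt0P; exists r.
  by move: leSm; rewrite cS; lia.
have clD : closed (@adj H) (mem (S :\: K)).
  by move=> u v uv; rewrite /= !in_setD; congr (~~ _ && _); [apply: clK | apply: clS].
have := IHm _ lt clD ne.
have := half_gt0 #|K|; have := half_gt0 #|S :\: K|.
by nra.
Qed.

(** A second component would give at least twice the value [2 * (1 / 2) ^+ n] of the cycle. *)
Lemma cycle_equiv_connected (r : H) : component r = [set: H].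
Proof.
set K := component r.
have clK : closed (@adj H) (mem K) := @component_closed H r.
have [cardH _ _] := cycle_equiv_counts.
apply/eqP; rewrite eqEsubset subsetT -setD_eq0 /=; apply: contraT => ne.
have clD : closed (@adj H) (mem ([set: H] :\: K)).
  by move=> u v uv; rewrite /= !in_setD; congr (~~ _ && _); [apply: clK | rewrite !inE].
have h1 := wt_closed_eval clD ne.
have : wt x0 [set: H] = 2 * (1 / 2) ^+ n by rewrite wtH cycle_wt_eval //; lia.
rewrite (wt_closed _ clK (subsetT _)) wt_component_eval -/K.
have -> : n = (#|K| + #|[set: H] :\: K|)%N.
  by rewrite -cardH -cardsT -(cardsID K [set: H]) setTI.
rewrite exprD; have := half_gt0 #|K|; have := half_gt0 #|[set: H] :\: K|.
by nra.
Qed.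

Lemma cycle_equiv_lolli : is_lolli H n n.-1 \/ is_lolli H n 2.
Proof.
have [cardH _ _] := cycle_equiv_counts.
have /card_gt0P[r _] : (0 < #|H|)%N by rewrite cardH; lia.
have [q [f [hq fP]]] := component_lolli r.
rewrite (cycle_equiv_connected r) in hq fP *; rewrite cardsT cardH in hq fP *.
by move=> cov; case: hq => hq; [right | left]; exists f; rewrite -?hq.
Qed.

End CycleEquivalent.

Theorem theorem19 (k p : nat) (hk : 0 < k) (hp : prime p) (hp5 : 5 <= p)
    (H : sgraph) :
  indep_class (cycle_graph (p ^ k)) H <->
  isomorphic H (cycle_graph (p ^ k)) \/ isomorphic H (D_graph (p ^ k)).
Proof.
have n2 : 2 < p ^ k.
  by apply: leq_trans (ltnW (ltnW hp5)) _; rewrite -[leqLHS]expn1 leq_exp2l //; lia.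
have cycL := cycle_is_lolli n2; have DL := D_is_lolli n2.
have wt_cyc (R : comNzRingType) (x : R) : wt x [set: cycle_graph (p ^ k)] = cycle_wt x (p ^ k).
  by apply: wt_is_lolli cycL => //; right.
rewrite indep_classP; split=> [h|].
  have [|Hl|Hl] := @cycle_equiv_lolli H p k hp hp5 hk; first by move=> R x; rewrite h.
    by left; apply: is_lolli_isomorphic Hl cycL.
  by right; apply: is_lolli_isomorphic Hl DL.
move=> h R x; rewrite wt_cyc; case: h => h.
  by apply: wt_is_lolli (isomorphic_is_lolli h cycL) => //; right.
by apply: wt_is_lolli (isomorphic_is_lolli h DL) => //; left.
Qed.
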